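(* Fix an integer $n\ge 3$. (1) For every integer $m\ge 2$: let Wilson's algorithm be run on $G_{n,m}$, with the root on one of the boundary rings $R_0,R_{m-1}$ and the first random walk started from a vertex of the other boundary ring. Then the first loop-erased path produced by the algorithm is a trunk, i.e. it is a simple path intersecting every ring $R_0,\dots,R_{m-1}$. (2) There exist constants $C=C(n)<\infty$ and $\theta=\theta(n)\in(0,1)$ such that the following holds for every integer $m\ge 2$, where $G$ is either $G_{n,m}$ or $G_{n,m}^{\mathrm s}$. Run Wilson's algorithm on $G$; in the wired case $G=G_{n,m}^{\mathrm s}$ assume it is rooted at the sink $s$. Suppose that the current Wilson tree $F$ at some stage intersects every ring $R_0,\dots,R_{m-1}$ (so in the wired case also $s\in F$). Let $\beta$ be the next nontrivial loop-erased increment, i.e. the loop-erased path added by the algorithm for the next starting vertex not in $F$. Then $$\mathbb P\bigl(|\beta|\ge \ell \mid F\bigr)\le C\,\theta^{\ell}\qquad\text{for all integers }\ell\ge 0,$$ where the constants $C,\theta$ are independent of $m$, of $F$, and of the starting vertex.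
   Context: For $n\ge 3$, $m\ge 2$, the cylindrical graph $G_{n,m}=C_n\times P_m$ has vertex set $\{(i,j): i\in\mathbb{Z}_n,\ j\in\{0,\dots,m-1\}\}$ and edges $\{(i,j),(i+1,j)\}$ ($i\in\mathbb{Z}_n$, $0\le j\le m-1$) and $\{(i,j),(i,j+1)\}$ ($i\in\mathbb{Z}_n$, $0\le j\le m-2$). Its rings are $R_k=\{(i,k): i\in\mathbb{Z}_n\}$, $k=0,\dots,m-1$; the boundary rings are $R_0$ and $R_{m-1}$. The wired cylindrical graph $G_{n,m}^{\mathrm s}$ is obtained from $G_{n,m}$ by adding one new vertex $s$ (the sink) and the edges $\{s,v\}$ for all $v\in R_0\cup R_{m-1}$. Loop-erasure: for a finite path $\gamma$, its (chronological) loop-erasure is obtained by iteratively erasing cycles in chronological order: whenever the path first revisits a vertex, delete the loop formed between the two occurrences. The length $|\beta|$ of a path $\beta$ is its number of edges. Wilson's algorithm on a finite connected graph $G=(V,E)$: choose a root $r\in V$ and an ordering of $V\setminus\{r\}$. Starting with the tree $\{r\}$, repeatedly take the first vertex in the ordering not yet in the current tree, run (independently of the past) simple random walk from it (each step moves to a uniformly chosen neighbour) until it first hits the current tree, and add the loop-erasure of this walk (the loop-erased increment) to the tree. A trunk of a spanning tree $T$ is a simple path $L\subset T$ with $L\cap R_k\ne\varnothing$ for every $k=0,\dots,m-1$. *)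

(* Defs.v *)
From HB Require Import structures.
From mathcomp Require Import all_boot all_order all_algebra.
From mathcomp Require Import all_classical all_reals all_analysis.

Set Implicit Arguments.
Unset Strict Implicit.
Unset Printing Implicit Defensive.

Import Order.TTheory GRing.Theory Num.Theory.

Local Open Scope ring_scope.

Section Cylinder.
Variables n m : nat.

(* [ordS] is the cyclic successor of 'I_n, i.e. i + 1 in Z_n. *)
Definition cyl_adj : rel ('I_n * 'I_m) := fun u v =>
  (u.2 == v.2) && ((v.1 == ordS u.1) || (u.1 == ordS v.1))
  || (u.1 == v.1) && ((v.2 == u.2.+1 :> nat) || (u.2 == v.2.+1 :> nat)).

Definition ring_of (k : 'I_m) : {set 'I_n * 'I_m} := [set v | v.2 == k]%SET.

Definition on_boundary (v : 'I_n * 'I_m) : bool :=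
  (v.2 == 0 :> nat)%N || (v.2 == m.-1 :> nat)%N.

(* The sink is [None]. *)
Definition wired_adj : rel (option ('I_n * 'I_m)) := fun u v =>
  match u, v with
  | Some a, Some b => cyl_adj a b
  | None, Some b => on_boundary b
  | Some a, None => on_boundary a
  | None, None => false
  end.

Definition wired_ring_of (k : 'I_m) : {set option ('I_n * 'I_m)} :=
  (Some @: ring_of k)%SET.

End Cylinder.

Section Graphs.
Variable V : finType.

(* A subgraph is given by its vertex set and its edge set; the edge between
   x and y is the unordered pair [set x; y]. *)
Definition subgraph : Type := ({set V} * {set {set V}})%type.
Definition vertices (T : subgraph) : {set V} := T.1.
Definition edges (T : subgraph) : {set {set V}} := T.2.

(* Paths are nonempty sequences of vertices, both endpoints included. *)
Definition path_length (p : seq V) : nat := (size p).-1.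

Definition path_edges (p : seq V) : {set {set V}} :=
  [set [set xy.1; xy.2] | xy in zip p (behead p)]%SET.

Definition path_subgraph (p : seq V) : subgraph :=
  ([set x in p]%SET, path_edges p).

Definition add_path (T : subgraph) (p : seq V) : subgraph :=
  ((vertices T :|: [set x in p])%SET, (edges T :|: path_edges p)%SET).

Definition is_simple_path (e : rel V) (p : seq V) : bool :=
  [&& p != [::], uniq p & sorted e p].

Definition edge_rel (T : subgraph) : rel V :=
  fun x y => ([set x; y] \in edges T)%SET.

Definition is_spanning_tree (e : rel V) (T : subgraph) : Prop :=
  [/\ vertices T = [set: V]%SET,
      forall E, E \in edges T -> exists x y, e x y /\ E = [set x; y]%SET,
      forall x y, connect (edge_rel T) x y &
      forall c, uniq c -> cycle (edge_rel T) c -> (size c <= 2)%N].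

Definition is_trunk (e : rel V) (m : nat) (ring : 'I_m -> {set V})
    (T : subgraph) (L : seq V) : Prop :=
  [/\ is_spanning_tree e T, is_simple_path e L,
      vertices (path_subgraph L) \subset vertices T,
      edges (path_subgraph L) \subset edges T &
      forall k, exists2 v, v \in L & v \in ring k].

(* The accumulator is the loop-erasure of the path read so far: on returning
   to a vertex x of it, the loop between the two visits of x is deleted. *)
Definition loop_erasure (p : seq V) : seq V :=
  foldl (fun q x => if x \in q then take (index x q).+1 q else rcons q x)
    [::] p.

Definition hitting_time (F : {set V}) (x : nat -> V) : option nat :=
  match pselect (exists k, x k \in F) with
  | left ex_hit => Some (ex_minn ex_hit)
  | right _ => None
  end.

(* Deterministic part of Wilson's algorithm: r is the root, o the ordering of
   the other vertices, X v the trajectory to be used if a walk is started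
   from v. [None] stands for a walk that never hits the current tree. *)
Section Wilson.
Variables (r : V) (o : seq V) (X : V -> nat -> V).

Definition next_start (T : subgraph) : option V :=
  ohead [seq v <- o | v \notin vertices T].

Definition increment_from (v : V) (T : subgraph) : option (seq V) :=
  omap (fun t => loop_erasure (mkseq (X v) t.+1))
       (hitting_time (vertices T) (X v)).

Definition wilson_step (T : subgraph) : option subgraph :=
  if next_start T is Some v then omap (add_path T) (increment_from v T)
  else Some T.

Definition wilson_tree (k : nat) : option subgraph :=
  iter k (obind wilson_step) (Some ([set r]%SET, finset.set0)).

Definition wilson_increment (k : nat) : option (seq V) :=
  obind (fun T => obind (fun v => increment_from v T) (next_start T))
        (wilson_tree k).

Definition wilson_output (T : subgraph) : Prop :=
  exists2 k, wilson_tree k = Some T & next_start T = None.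

End Wilson.

Definition is_ordering (r : V) (o : seq V) : Prop :=
  uniq o /\ (forall v, (v \in o) = (v != r)).

End Graphs.

Section Walks.
Context (R : realType) (d : measure_display) (Omega : measurableType d).
Variable P : probability Omega R.
Variables (V : finType) (e : rel V).

Definition srw_step (x y : V) : R :=
  if e x y then (#|[pred z | e x z]|%:R)^-1 else 0.

Definition is_srw (v : V) (X : nat -> Omega -> V) : Prop :=
  [/\ forall k x, measurable [set w | X k w = x]%classic,
      P [set w | X 0%N w = v]%classic = 1%E &
      forall (k : nat) (p : nat -> V),
        P [set w | forall i, (i <= k.+1)%N -> X i w = p i]%classic =
        ((srw_step (p k) (p k.+1))%:E *
         P [set w | forall i, (i <= k)%N -> X i w = p i]%classic)%E].

Definition sigma_of (X : nat -> Omega -> V) : set (set Omega) :=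
  <<s [set A | exists k x, A = [set w | X k w = x]] >>%classic.

Definition independent_walks (o : seq V) (W : V -> nat -> Omega -> V) : Prop :=
  forall (J : {set V}) (A : V -> set Omega),
    {subset J <= o} ->
    (forall v, v \in J -> sigma_of (W v) (A v)) ->
    P [set w | forall v, v \in J -> A v w]%classic
    = (\prod_(v in J) P (A v))%E.

(* The algorithm starts at most one walk from each vertex, so its randomness is
   encoded by one walk per vertex of the ordering. *)
Definition wilson_walks (o : seq V) (W : V -> nat -> Omega -> V) : Prop :=
  (forall v, v \in o -> is_srw v (W v)) /\ independent_walks o W.

Definition walks_at (W : V -> nat -> Omega -> V) (w : Omega) : V -> nat -> V :=
  fun v k => W v k w.

Definition cond_prob (A B : set Omega) : R :=
  fine (P (A `&` B)%classic) / fine (P B).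

End Walks.

(* Uniform tail bound for the increment following any stage k at which the
   Wilson tree F, rooted at r, meets every ring and is not yet spanning. *)
Definition increment_tail_bound (R : realType) (V : finType) (e : rel V)
    (m : nat) (ring : 'I_m -> {set V}) (r : V) (C theta : R) : Prop :=
  forall (d : measure_display) (Omega : measurableType d)
         (P : probability Omega R) (o : seq V) (W : V -> nat -> Omega -> V)
         (k : nat) (F : subgraph V) (l : nat),
  is_ordering r o ->
  wilson_walks P e o W ->
  (forall j : 'I_m, (vertices F :&: ring j != finset.set0)%SET) ->
  vertices F != [set: V]%SET ->
  let treeF := [set w | wilson_tree r o (walks_at W w) k = Some F]%classic in
  let long := [set w | exists2 beta,
      wilson_increment r o (walks_at W w) k = Some beta &
      (l <= path_length beta)%N]%classic in
  (0 < P treeF)%E ->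
  cond_prob P long treeF <= C * theta ^+ l.

(* Main.v *)
(** Part (1) is deterministic once the walks make nearest-neighbour steps and
    hit the root, which happens almost surely: consecutive vertices of a path
    lie in equal or adjacent rings, so a path between the boundary rings meets
    all of them.

    For part (2), [|beta|] is at most the hitting time of [F].  From any vertex
    off [F] the walk can go around its ring and meet [F] within [n] steps; all
    degrees are at most 5 (a crude bound, sufficient here), so this has
    probability at least [5 ^- n], uniformly in [m] and [F], and the hitting
    time has a geometric tail.  Conditioning on [F] is harmless because the walk
    from a vertex outside [F] is independent of the tree built so far. *)

Require Import Defs.
From HB Require Import structures.
From mathcomp Require Import all_boot all_order all_algebra.
From mathcomp Require Import all_classical all_reals all_analysis.
From mathcomp Require Import zify lra.


Set Implicit Arguments.
Unset Strict Implicit.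
Unset Printing Implicit Defensive.

Import Order.TTheory GRing.Theory Num.Theory.
Import numFieldNormedType.Exports.
Local Open Scope ring_scope.

(** * Loop-erasure and trees built by Wilson's algorithm *)

Section LoopErasure.
Variable V : finType.
Implicit Types (x y : V) (p s : seq V) (e : rel V).

Lemma loop_erasure_rcons p x :
  loop_erasure (rcons p x) =
  if x \in loop_erasure p
  then take (index x (loop_erasure p)).+1 (loop_erasure p)
  else rcons (loop_erasure p) x.
Proof. by rewrite /loop_erasure -cats1 foldl_cat. Qed.

Lemma size_loop_erasure p : (size (loop_erasure p) <= size p)%N.
Proof.
elim/last_ind: p => // p x IHp; rewrite loop_erasure_rcons size_rcons.
case: ifP => _; last by rewrite size_rcons.
by apply: leq_trans (leqW IHp); rewrite size_take_min geq_minr.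
Qed.

(** The path is read one last vertex at a time: a fresh vertex extends the erasure, a revisited one
    cuts it back to the prefix ending there. Both moves keep a simple path with the right
    endpoints. *)
Lemma loop_erasure_path e x s : path e x s ->
  exists q, [/\ loop_erasure (x :: s) = x :: q, uniq (x :: q), path e x q,
                last x q = last x s & {subset x :: q <= x :: s}].
Proof.
elim/last_ind: s => [_|s y IHs]; first by exists [::]; split.
rewrite rcons_path => /andP[/IHs[q [Eq Uq Pq Lq Sq]] ey].
rewrite -rcons_cons loop_erasure_rcons Eq.
have Sy z : z \in x :: s -> z \in x :: rcons s y.
  by rewrite -rcons_cons mem_rcons in_cons orbC => ->.
case: ifP => yq; last first.
  exists (rcons q y); rewrite -!rcons_cons rcons_uniq yq Uq rcons_path Pq Lq ey.
  split=> //; first by rewrite !last_rcons.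
  move=> z; rewrite !mem_rcons !(in_cons y).
  by case/orP => [->//|/Sq ->]; rewrite orbT.
set k := index y (x :: q); have kq : (k <= size q)%N.
  by rewrite -ltnS -[X in (_ < X)%N]/(size (x :: q)) index_mem.
exists (take k q); split => //.
- by rewrite -[x :: take k q]/(take k.+1 (x :: q)) take_uniq.
- exact: take_path.
- rewrite last_rcons (last_nth x) size_takel //.
  by rewrite -[x :: take k q]/(take k.+1 (x :: q)) nth_take // nth_index.
- move=> z; rewrite in_cons => /orP[/eqP->|/mem_take zq].
    by rewrite mem_head.
  by apply/Sy/Sq; rewrite in_cons zq orbT.
Qed.

Lemma loop_erasure_sub p : {subset loop_erasure p <= p}.
Proof.
case: p => // x s.
(* Containment does not involve adjacency, so the full relation makes any sequence a path. *)
have P : path (fun _ _ => true) x s by elim: s x => //=.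
by have [q [-> _ _ _]] := loop_erasure_path P.
Qed.

Lemma loop_erasure_head x s : exists q, loop_erasure (x :: s) = x :: q.
Proof.
have P : path (fun _ _ => true) x s by elim: s x => //=.
by have [q []] := loop_erasure_path P; exists q.
Qed.

End LoopErasure.

(** * First hitting times *)

Section HittingTime.
Variable V : finType.
Implicit Types (F : {set V}) (x : nat -> V).

Lemma hitting_timeP F x t :
  hitting_time F x = Some t <->
  x t \in F /\ (forall i, (i < t)%N -> x i \notin F).
Proof.
rewrite /hitting_time; case: pselect => [ex|nex]; last first.
  by split=> // -[xt _]; case: nex; exists t.
case: ex_minnP => m xm mle; split=> [[<-]|[xt lt_t]].
  by split=> // i; apply: contraTN => /mle; rewrite -leqNgt.
congr Some; apply/eqP; rewrite eqn_leq mle //= leqNgt.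
by apply: contraTN xm => /lt_t.
Qed.

Lemma hitting_time_some F x k : x k \in F -> exists t, hitting_time F x = Some t.
Proof.
move=> xk; rewrite /hitting_time; case: pselect => [ex|[]]; last by exists k.
by exists (ex_minn ex).
Qed.

Lemma increment_fromP (X : V -> nat -> V) v (T : subgraph V) b :
  increment_from X v T = Some b <->
  exists t, [/\ X v t \in vertices T,
                forall i, (i < t)%N -> X v i \notin vertices T &
                b = loop_erasure (mkseq (X v) t.+1)].
Proof.
rewrite /increment_from; split.
  case E: hitting_time => [t|] //= [<-]; exists t.
  by have [? ?] := (hitting_timeP _ _ _).1 E.
case=> t [h1 h2 ->]; suff -> : hitting_time (vertices T) (X v) = Some t by [].
exact/hitting_timeP.
Qed.

End HittingTime.

(** * Trees grown by attaching leaves and paths *)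

Section Trees.
Variables (V : finType) (e : rel V).
Implicit Types (T : subgraph V) (x y : V).

(** The invariant of the algorithm: the spanning-tree conditions relative to the current vertex set.
    Cycles of size 2 are allowed since they run back and forth along one edge. *)
Definition is_subtree T : Prop :=
  [/\ forall E, E \in edges T ->
        exists x y, [/\ e x y, x \in vertices T, y \in vertices T
                      & E = [set x; y]%SET],
      {in vertices T &, forall x y, connect (edge_rel T) x y} &
      forall c, uniq c -> cycle (edge_rel T) c -> (size c <= 2)%N].

Definition add_leaf T x y : subgraph V :=
  ((x |: vertices T)%SET, ([set x; y] |: edges T)%SET).

Lemma edge_rel_sym T : symmetric (edge_rel T).
Proof. by move=> x y; rewrite /edge_rel finset.setUC. Qed.

Lemma edge_rel_vertex T x y : is_subtree T -> edge_rel T x y -> x \in vertices T.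
Proof.
move=> [Te _ _] /Te[a [b [_ aT bT E]]].
have: x \in [set a; b]%SET by rewrite -E !inE eqxx.
by rewrite !inE => /orP[] /eqP->.
Qed.

Lemma edge_rel_add_leaf T x y a b :
  edge_rel (add_leaf T x y) a b =
  ([set a; b]%SET == [set x; y]%SET) || edge_rel T a b.
Proof. by rewrite /edge_rel !inE. Qed.

(** In the enlarged graph [y] is the only neighbour of [x], so [x] lies on no cycle of three or more
    vertices, and a cycle avoiding [x] already lives in [T]. *)
Lemma is_subtree_add_leaf T x y : is_subtree T ->
  y \in vertices T -> x \notin vertices T -> e x y ->
  is_subtree (add_leaf T x y).
Proof.
move=> sT yT xT exy; have [Te Tc Ta] := sT.
have nbr b : edge_rel (add_leaf T x y) x b -> b = y.
  rewrite edge_rel_add_leaf => /orP[/eqP E|/(edge_rel_vertex sT)]; last first.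
    by rewrite (negPf xT).
  have: b \in [set x; y]%SET by rewrite -E !inE eqxx orbT.
  rewrite !inE => /orP[] /eqP // bx.
  have: y \in [set x; b]%SET by rewrite E !inE eqxx orbT.
  by rewrite bx !inE orbb => /eqP yx; rewrite -yx yT in xT.
have exy' : edge_rel (add_leaf T x y) x y by rewrite edge_rel_add_leaf eqxx.
split.
- move=> E; rewrite !inE => /orP[/eqP->|/Te[a [b [ab aT bT ->]]]].
    by exists x, y; rewrite !inE eqxx yT orbT.
  by exists a, b; rewrite !inE aT bT !orbT.
- have cT : {in vertices T &, forall a b, connect (edge_rel (add_leaf T x y)) a b}.
    move=> a b aT bT; apply: connect_sub (Tc a b aT bT) => u v uv.
    by apply: connect1; rewrite edge_rel_add_leaf uv orbT.
  have cx a : a \in vertices T -> connect (edge_rel (add_leaf T x y)) x a.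
    by move=> aT; apply: connect_trans (connect1 exy') _; exact: cT.
  move=> a b; rewrite !inE => /orP[/eqP->|aT] /orP[/eqP->|bT].
  + exact: connect0.
  + exact: cx.
  + by rewrite (sym_connect_sym (@edge_rel_sym _)) cx.
  + exact: cT.
- move=> c Uc Cc; have [xc|xc] := boolP (x \in c); last first.
    apply: Ta => //; apply: (sub_in_cycle (P := mem c)) Cc; last exact/allP.
    move=> a b ac bc; rewrite edge_rel_add_leaf => /orP[/eqP E|//].
    have: x \in [set a; b]%SET by rewrite E !inE eqxx.
    by rewrite !inE => /orP[] /eqP xE; rewrite xE ?ac ?bc in xc.
  (* Rotated to start at [x], the cycle has neighbours of [x] as second and as last vertex; both
     equal [y], so distinctness leaves at most two vertices. *)
  have [i c' Ec] := rot_to xc.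
  have := Cc; have := Uc; rewrite -(size_rot i) -(rot_cycle i) -(rot_uniq i) Ec.
  case: c' {Ec} => [//|b c'] /= /and3P[_ bc _].
  rewrite rcons_path => /and3P[/nbr by_ _]; rewrite edge_rel_sym => /nbr.
  case: c' bc => //= a c'; rewrite by_ => bc E.
  by move: bc; rewrite -E mem_last.
Qed.

Lemma path_edges_cons x y (p : seq V) :
  path_edges [:: x, y & p] = ([set x; y] |: path_edges (y :: p))%SET.
Proof.
apply/setP => E; rewrite !inE; apply/imsetP/orP.
  case=> -[a b] /=; rewrite in_cons => /orP[/eqP[-> ->] ->|h ->].
    by left.
  by right; apply/imsetP; exists (a, b).
case=> [/eqP->|/imsetP[ab h ->]]; first by exists (x, y); rewrite ?mem_head.
by exists ab => //=; rewrite in_cons h orbT.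
Qed.

(** The path is grown backwards from its end in [T]: each earlier vertex is a new leaf attached to
    its successor. *)
Lemma is_subtree_add_path T x p : is_subtree T -> path e x p -> uniq (x :: p) ->
  last x p \in vertices T -> {in belast x p, forall z, z \notin vertices T} ->
  is_subtree (add_path T (x :: p)).
Proof.
move=> sT; elim: p x => [|y p IHp] x.
  move=> _ _ /= xT _; suff -> : add_path T [:: x] = T by [].
  case: T xT {sT} => TV TE /=; rewrite /add_path /vertices /edges /= => xT.
  congr pair; apply/setP => z; rewrite !inE.
    by case: eqP => [->|]; rewrite ?xT ?orbF.
  by case: imsetP => [[? //]|]; rewrite orbF.
move=> /= /andP[exy pp] /andP[xyp Uyp] lT blT.
have -> : add_path T [:: x, y & p] = add_leaf (add_path T (y :: p)) x y.
  rewrite /add_leaf /add_path path_edges_cons; congr pair; apply/setP => z.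
    by rewrite !inE orbCA.
  by rewrite !inE orbCA.
apply: is_subtree_add_leaf => //.
- by apply: IHp => // z zp; apply: blT; rewrite in_cons zp orbT.
- by rewrite !inE eqxx orbT.
- by rewrite finset.in_setU negb_or blT ?mem_head //= inE.
Qed.

End Trees.

(** * Wilson's algorithm along fixed trajectories *)

Section WilsonRun.
Variables (V : finType) (e : rel V) (r : V) (o : seq V) (X : V -> nat -> V).
Hypothesis ord_o : is_ordering r o.
Hypothesis X_start : forall v, v \in o -> X v 0%N = v.
Hypothesis X_step : forall v k, v \in o -> e (X v k) (X v k.+1).
Hypothesis X_hit : forall v, v \in o -> exists k, X v k = r.
Implicit Types T : subgraph V.

Lemma next_start_some T v : next_start o T = Some v ->
  v \in o /\ v \notin vertices T.
Proof.
rewrite /next_start; case E: [seq _ <- o | _] => [//|a s] [<-].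
have : a \in [seq v <- o | v \notin vertices T] by rewrite E mem_head.
by rewrite mem_filter => /andP[].
Qed.

Lemma next_start_none T : r \in vertices T -> next_start o T = None ->
  vertices T = [set: V]%SET.
Proof.
move=> rT E; apply/setP => v; rewrite inE; have [->//|vr] := eqVneq v r.
have: v \in o by rewrite ord_o.2.
apply: contraTT => vT; apply/negP => vo; move: E; rewrite /next_start.
have : v \in [seq v <- o | v \notin vertices T] by rewrite mem_filter vT.
by case: [seq _ <- o | _].
Qed.

Lemma increment_spec v T : v \in o -> v \notin vertices T -> r \in vertices T ->
  exists p, [/\ increment_from X v T = Some (v :: p), path e v p,
    uniq (v :: p), last v p \in vertices T &
    {in belast v p, forall z, z \notin vertices T}].
Proof.
move=> vo vT rT; have [k Xk] := X_hit vo.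
have [|t /hitting_timeP[Xt Xlt]] := @hitting_time_some V (vertices T) (X v) k.
  by rewrite Xk.
have Et : mkseq (X v) t.+1 = v :: mkseq (fun i => X v i.+1) t.
  by rewrite /mkseq /= X_start // -[1%N]addn0 iotaDl -map_comp.
have Pt : path e v (mkseq (fun i => X v i.+1) t).
  apply/(pathP v) => i; rewrite size_mkseq => it.
  rewrite -Et !nth_mkseq ?X_step //; exact: ltnW.
have [q [Eq Uq Pq Lq Sq]] := loop_erasure_path Pt.
exists q; split => //.
- by apply/increment_fromP; exists t; rewrite Et Eq.
- by rewrite Lq -(last_cons v) -Et mkseqS last_rcons.
(* Only the last position of the stopped walk lies in [T], so it is appended to the erasure of the
   earlier positions, all of which are off [T]. *)
- have LEsub : {subset loop_erasure (mkseq (X v) t) <= mkseq (X v) t}.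
    exact: loop_erasure_sub.
  have LEnot z : z \in mkseq (X v) t -> z \notin vertices T.
    by move=> /mapP[i]; rewrite mem_iota => /Xlt + ->.
  have: loop_erasure (mkseq (X v) t.+1) = rcons (loop_erasure (mkseq (X v) t)) (X v t).
    rewrite mkseqS loop_erasure_rcons ifF //; apply/negP => /LEsub Xin.
    by have /negP[] := LEnot _ Xin.
  by rewrite Et Eq lastI => /rcons_inj[-> _] z /LEsub/LEnot.
Qed.

Lemma wilson_step_spec T : is_subtree e T -> r \in vertices T ->
  exists T', [/\ wilson_step o X T = Some T', is_subtree e T',
    vertices T \subset vertices T' /\ edges T \subset edges T' &
    next_start o T = None \/ (#|vertices T| < #|vertices T'|)%N].
Proof.
move=> sT rT; rewrite /wilson_step; case E: next_start => [v|]; last first.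
  by exists T; split => //; left.
have [vo vT] := next_start_some E.
have [p [-> Pp Up Lp Bp]] := increment_spec vo vT rT.
exists (add_path T (v :: p)); split => //.
- exact: is_subtree_add_path.
- by split; apply: finset.subsetUl.
- right; apply/proper_card/properP; split; first exact: finset.subsetUl.
  by exists v => //; rewrite !inE eqxx orbT.
Qed.

(** The cardinality alternative yields termination: once [k] exceeds [#|V|], only
    [next_start o T = None] remains. *)
Lemma wilson_iter_spec T0 k : is_subtree e T0 -> r \in vertices T0 ->
  exists T, [/\ iter k (obind (wilson_step o X)) (Some T0) = Some T,
    is_subtree e T,
    vertices T0 \subset vertices T /\ edges T0 \subset edges T &
    next_start o T = None \/ (k <= #|vertices T|)%N].
Proof.
move=> s0 r0; elim: k => [|k [T [ET sT [v0T e0T] hT]]].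
  by exists T0; split => //; right.
have rT : r \in vertices T by apply: (fintype.subsetP v0T).
have [T' [ET' sT' [vTT' eTT'] hT']] := wilson_step_spec sT rT.
exists T'; split => //.
- by rewrite iterS ET.
- by split; [apply: fintype.subset_trans v0T _ | apply: fintype.subset_trans e0T _].
- case: hT' => [nT|lt]; last first.
    case: hT => [nT|le]; last by right; apply: leq_trans lt.
    by left; move: ET'; rewrite /wilson_step nT => -[<-].
  by left; move: ET'; rewrite /wilson_step nT => -[<-].
Qed.

Lemma is_subtree_root : is_subtree e ([set r]%SET, finset.set0 : {set {set V}}).
Proof.
split=> [E|x y|c _]; first by rewrite inE.
  by rewrite !inE => /eqP-> /eqP->; apply: connect0.
case: c => [|x [|y c]] //= /andP[]; by rewrite /edge_rel inE.
Qed.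

(** Deterministic core of part (1): the first increment ends at [r], the only vertex of the initial
    tree, and survives in the output because later steps only enlarge the tree. *)
Lemma wilson_spanning v o' : o = v :: o' ->
  exists L T p, [/\ wilson_increment r o X 0 = Some L,
    wilson_output r o X T, is_spanning_tree e T,
    [/\ L = v :: p, path e v p, uniq L & last v p = r] &
    vertices (path_subgraph L) \subset vertices T /\
    edges (path_subgraph L) \subset edges T].
Proof.
move=> Eo; have vo : v \in o by rewrite Eo mem_head.
pose T0 : subgraph V := ([set r]%SET, finset.set0).
have r0 : r \in vertices T0 by rewrite inE.
have v0 : v \notin vertices T0 by rewrite inE -ord_o.2.
have E0 : next_start o T0 = Some v by rewrite /next_start Eo /= v0.
have [p [Ep Pp Up Lp Bp]] := increment_spec vo v0 r0.
set L := v :: p; pose T1 := add_path T0 L.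
have s1 : is_subtree e T1 by apply: is_subtree_add_path => //; apply: is_subtree_root.
have r1 : r \in vertices T1 by rewrite !inE eqxx.
have [T [ET [Te Tc Ta] [vT eT] hT]] := wilson_iter_spec #|V|.+1 s1 r1.
have nT : next_start o T = None.
  by case: hT => //; rewrite ltnNge max_card.
have TV : vertices T = [set: V]%SET.
  by apply: next_start_none nT; apply: (fintype.subsetP vT).
exists L, T, p; split.
- by rewrite /wilson_increment /= -/T0 E0.
- exists #|V|.+2 => //; rewrite /wilson_tree iterSr /= -/T0 /wilson_step E0 Ep.
  exact: ET.
- split => //.
  + by move=> E /Te[a [b [ab _ _ ->]]]; exists a, b.
  + by move=> x y; apply: Tc; rewrite TV inE.
- by split => //; move: Lp; rewrite inE => /eqP.
- split.
    by apply: fintype.subset_trans vT; apply: finset.subsetUr.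
  by apply: fintype.subset_trans eT; apply: finset.subsetUr.
Qed.

End WilsonRun.

(** * Geometric decay of the hitting time *)

Section Avoid.
Variables (R : realType) (V : finType) (e : rel V) (F : {set V}).

(* Probability that the walk started at [x] stays off [F] at times 1, ..., j;
   [x] itself may lie in [F]. *)
Fixpoint avoid (j : nat) (x : V) : R :=
  if j is j'.+1 then \sum_(y | y \notin F) srw_step R e x y * avoid j' y else 1.

Lemma srw_step_ge0 x y : 0 <= srw_step R e x y.
Proof. by rewrite /srw_step; case: ifP => // _; rewrite invr_ge0. Qed.

Lemma sum_srw_step_le1 x : \sum_y srw_step R e x y <= 1.
Proof.
rewrite /srw_step -big_mkcond /= sumr_const.
set N := #|_|; have [->|N0] := eqVneq N 0%N; first by rewrite mulr0n.
by rewrite -[X in X <= _]mulr_natl mulfV // pnatr_eq0.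
Qed.

Lemma avoid_ge0 j x : 0 <= avoid j x.
Proof.
elim: j x => //= j IHj x; apply: sumr_ge0 => y _.
by rewrite mulr_ge0 ?srw_step_ge0.
Qed.

Lemma avoid_le1 j x : avoid j x <= 1.
Proof.
elim: j x => //= j IHj x; apply: le_trans (sum_srw_step_le1 x).
rewrite big_mkcond; apply: ler_sum => y _.
by case: ifP => _; rewrite ?srw_step_ge0 // ler_piMr ?srw_step_ge0.
Qed.

(** Following [p] leads into [F] with probability at least [delta ^+ size p]; [delta <= 1] allows
    the exponent to be raised to [j]. *)
Lemma avoid_path (delta : R) j x p : 0 <= delta -> delta <= 1 ->
  (forall x y, x \notin F -> e x y -> delta <= srw_step R e x y) ->
  path e x p -> x \notin F -> last x p \in F -> (size p <= j)%N ->
  avoid j x <= 1 - delta ^+ j.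
Proof.
move=> d0 d1 dF; elim: j x p => [|j IHj] x [|y p] //=.
- by move=> _ /negPf ->.
- by move=> _ /negPf ->.
move=> /andP[exy pp] xF lF; rewrite ltnS => pj.
set b := if y \in F then 0 else avoid j y.
have b0 : 0 <= b by rewrite /b; case: ifP => // _; apply: avoid_ge0.
have b1 : b <= 1 - delta ^+ j.
  rewrite /b; case: ifPn => yF; last exact: IHj pp yF lF pj.
  by rewrite subr_ge0 exprn_ile1.
(* First steps other than the one to [y] get the trivial bound 1, so the total is at most
   [1 - s * (1 - b)], with [s] the probability of stepping to [y]. *)
apply: (@le_trans _ _ (\sum_z srw_step R e x z * (if z == y then b else 1))).
  rewrite big_mkcond; apply: ler_sum => z _; have s0 := srw_step_ge0 x z.
  case: ifPn => zF; last first.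
    by rewrite mulr_ge0 //; case: ifP.
  rewrite ler_wpM2l //; case: eqP => [zy|_]; last exact: avoid_le1.
  by rewrite /b -zy (negPf zF).
have := sum_srw_step_le1 x; rewrite (bigD1 y) //= => S1.
rewrite (bigD1 y) //= eqxx.
rewrite [X in _ + X](eq_bigr (fun z => srw_step R e x z)); last first.
  by move=> z /negPf ->; rewrite mulr1.
set s := srw_step R e x y in S1 *; have sd : delta <= s by exact: dF.
set S := \sum_(_ | _) _ in S1 *.
have h : delta * delta ^+ j <= s * (1 - b).
  by apply: ler_pM => //; [exact: exprn_ge0 | lra].
rewrite exprS; lra.
Qed.

(** Markov property: wherever the walk stands off [F] after [k] steps, the next [N] steps avoid [F]
    with probability at most [q]. *)
Lemma avoid_add (q : R) N : (forall x, x \notin F -> avoid N x <= q) ->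
  forall k x, x \notin F -> avoid (k + N) x <= q * avoid k x.
Proof.
move=> hq; elim=> [|k IHk] x xF; first by rewrite mulr1 add0n hq.
rewrite addSn /= mulr_sumr; apply: ler_sum => y yF.
by rewrite mulrCA ler_wpM2l ?srw_step_ge0 ?IHk.
Qed.

(** Each full block of [N] steps costs a factor [theta ^+ N]; the constant [theta ^- N] absorbs the
    incomplete block, for which the bound is at least 1. *)
Lemma avoid_geometric (theta : R) N : (0 < N)%N -> 0 < theta -> theta <= 1 ->
  (forall x, x \notin F -> avoid N x <= theta ^+ N) ->
  forall j x, x \notin F -> avoid j x <= theta ^- N * theta ^+ j.
Proof.
move=> N0 t0 t1 hN j; have [k] := ubnP j; elim: k j => // k IHk j jk x xF.
have tN0 : 0 < theta ^+ N by rewrite exprn_gt0.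
have [Nj|jN] := leqP N j; last first.
  apply: le_trans (avoid_le1 j x) _; rewrite mulrC ler_pdivlMr // mul1r.
  exact: ler_wiXn2l (ltW t0) t1 _ _ (ltnW jN).
rewrite -(subnK Nj) exprD mulrA mulrC.
apply: le_trans (avoid_add hN _ xF) _; rewrite ler_pM2l // IHk //.
by rewrite ltnS in jk; apply: leq_trans jk; rewrite ltn_subrL N0 (leq_trans N0).
Qed.

End Avoid.

(** * An explicit decay rate *)

Section DecayRate.
Variable R : realType.

(* Bernoulli's inequality makes [decay_rate D N ^+ N] at least [1 - D ^- N],
   which avoids an [N]-th root. *)
Definition decay_rate (D N : nat) : R := 1 - D%:R ^- N / N.+1%:R.

Lemma bernoulli (x : R) N : 0 <= x -> x <= 1 -> 1 - N%:R * x <= (1 - x) ^+ N.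
Proof.
move=> x0 x1; elim: N => [|N IHN]; first by rewrite mul0r subr0.
rewrite exprS; apply: (@le_trans _ _ ((1 - x) * (1 - N%:R * x))).
  have : 0 <= N%:R * (x * x) by rewrite !mulr_ge0.
  rewrite -natr1; lra.
by rewrite ler_wpM2l // subr_ge0.
Qed.

Lemma decay_rate_bounds D N : (0 < D)%N -> (0 < N)%N ->
  [/\ 0 < decay_rate D N, decay_rate D N < 1 &
      1 - D%:R ^- N <= decay_rate D N ^+ N].
Proof.
move=> D0 N0; have D0' : 0 < D%:R :> R by rewrite ltr0n.
set d : R := D%:R ^- N.
have d0 : 0 < d by rewrite invr_gt0 exprn_gt0.
have d1 : d <= 1 by rewrite invf_le1 ?exprn_gt0 // exprn_ege1 // ler1n.
have NS0 : 0 < N.+1%:R :> R by rewrite ltr0n.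
have x0 : 0 < d / N.+1%:R by rewrite divr_gt0.
(* The denominator [N.+1] keeps the ratio below 1 even when [d] and [N] both equal 1. *)
have x1 : d / N.+1%:R < 1.
  by rewrite ltr_pdivrMr // mul1r (le_lt_trans d1) // ltr1n.
rewrite /decay_rate -/d; split; first by rewrite subr_gt0.
  by rewrite ltrBlDr ltrDl.
apply: le_trans (bernoulli N (ltW x0) (ltW x1)); rewrite lerB //.
rewrite mulrCA ger_pMr // ler_pdivrMr // mul1r ler_nat //.
Qed.

End DecayRate.

(** * Simple random walks *)

Section SigmaAlgebras.
Context (R : realType) (d : measure_display) (Omega : measurableType d).
Local Open Scope classical_set_scope.

Lemma measure_bigcup_finType (mu : {content set Omega -> \bar R}) (I : finType)
    (D : I -> set Omega) : (forall i, measurable (D i)) ->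
  (forall i j w, D i w -> D j w -> i = j) ->
  mu (\bigcup_i D i) = (\sum_i mu (D i))%E.
Proof.
move=> mD disj; rewrite measure_fin_bigcup //; last by move=> i j _ _ [w []]; apply: disj.
rewrite [RHS]fsbig_seq ?index_enum_uniq //.
  by apply: eq_fsbigl; apply/seteqP; split=> // i _ /=; rewrite mem_index_enum.
exact: finite_finset.
Qed.

Variable V : finType.
Implicit Types X : nat -> Omega -> V.

Lemma sigma_of_setI X A B : sigma_of X A -> sigma_of X B -> sigma_of X (A `&` B).
Proof. exact: (@measurableI _ (g_sigma_algebraType _)). Qed.

Lemma sigma_of_bigcup_finType X (I : finType) (A : I -> set Omega) :
  (forall i, sigma_of X (A i)) -> sigma_of X (\bigcup_i A i).
Proof.
move=> mA; apply: (@fin_bigcup_measurable _ (g_sigma_algebraType _)) => [|i _].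
  exact: finite_finset.
exact: mA.
Qed.

Lemma sigma_of_const X (Q : Prop) : sigma_of X [set _ | Q].
Proof.
have [q|q] := pselect Q.
  rewrite (_ : [set _ | _] = setT); last by apply/seteqP; split=> w.
  exact: (@measurableT _ (g_sigma_algebraType _)).
rewrite (_ : [set _ | _] = set0); last by apply/seteqP; split=> w.
exact: sigma_algebra0.
Qed.

(** Since [V] is finite, splitting on the last value writes the event as a finite union, whatever
    the predicate [Q]. *)
Lemma sigma_of_prefix X t (Q : seq V -> Prop) :
  sigma_of X [set w | Q (mkseq (X^~ w) t)].
Proof.
elim: t Q => [|t IHt] Q; first exact: (sigma_of_const (Q [::])).
have -> : [set w | Q (mkseq (X^~ w) t.+1)] =
    \bigcup_y ([set w | X t w = y] `&` [set w | Q (rcons (mkseq (X^~ w) t) y)]).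
  apply/seteqP; split=> w /=; first by rewrite mkseqS; exists (X t w).
  by case=> y _ [/= <-]; rewrite mkseqS.
apply: sigma_of_bigcup_finType => y; apply: sigma_of_setI.
  by apply: sub_sigma_algebra; exists t, y.
exact: (IHt (fun s => Q (rcons s y))).
Qed.

Lemma sigma_of_finite_time X t (Q : (nat -> V) -> Prop) :
  (forall x y, (forall i, (i < t)%N -> x i = y i) -> Q x -> Q y) ->
  sigma_of X [set w | Q (X^~ w)].
Proof.
move=> Qt; pose Q' s := exists x, mkseq x t = s /\ Q x.
rewrite (_ : [set w | _] = [set w | Q' (mkseq (X^~ w) t)]).
  exact: sigma_of_prefix.
apply/seteqP; split=> w /=; first by exists (X^~ w).
case=> x [Ex Qx]; apply: Qt Qx => i it.
by rewrite -[LHS](nth_mkseq (x 0%N) x it) Ex nth_mkseq.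
Qed.

(** The event is a countable union over the hitting time [t] of events fixed by the first [t.+1]
    positions of the walk from [v] alone. *)
Lemma sigma_of_increment_from (W : V -> nat -> Omega -> V) v (T : subgraph V)
    (Q : seq V -> Prop) :
  sigma_of (W v)
    [set w | exists2 b, increment_from (walks_at W w) v T = Some b & Q b].
Proof.
pose E t := [set w | [/\ W v t w \in vertices T,
  forall i, (i < t)%N -> W v i w \notin vertices T &
  Q (loop_erasure (mkseq (W v ^~ w) t.+1))]].
rewrite (_ : [set w | _] = \bigcup_t E t).
  apply: sigma_algebra_bigcup => t.
  apply: (@sigma_of_finite_time _ t.+1 (fun x => [/\ x t \in vertices T,
    forall i, (i < t)%N -> x i \notin vertices T &
    Q (loop_erasure (mkseq x t.+1))])).
  move=> x y xy [xt xlt Qx]; split.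
  - by rewrite -xy.
  - by move=> i it; rewrite -xy ?xlt // ltnW.
  - rewrite (_ : mkseq y t.+1 = mkseq x t.+1) //.
    by apply/eq_in_map => i; rewrite mem_iota => /andP[_ it]; rewrite xy.
apply/seteqP; split=> w /=.
  by case=> b /increment_fromP[t [Xt Xlt ->]] Qb; exists t.
case=> t _ [Xt Xlt Qt]; exists (loop_erasure (mkseq (W v ^~ w) t.+1)) => //.
by apply/increment_fromP; exists t.
Qed.

End SigmaAlgebras.

(** * Markov property and hitting tails of one walk *)

Section Walk.
Context (R : realType) (d : measure_display) (Omega : measurableType d).
Variables (P : probability Omega R) (V : finType) (e : rel V) (v : V).
Variable X : nat -> Omega -> V.
Hypothesis srwX : is_srw P e v X.
Local Open Scope classical_set_scope.

Lemma srw_measurable A : sigma_of X A -> measurable A.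
Proof.
have [mX _ _] := srwX; apply: smallest_sub; first exact: sigma_algebra_measurable.
by move=> B [k [x ->]].
Qed.

Let cyl (p : nat -> V) (k : nat) := [set w | forall i, (i <= k)%N -> X i w = p i].

Let cyl_avoid (F : {set V}) p k j := [set w |
  (forall i, (i <= k)%N -> X i w = p i) /\
  (forall i, (k < i <= k + j)%N -> X i w \notin F)].

Let cyl_avoid_measurable F p k j : measurable (cyl_avoid F p k j).
Proof.
apply: srw_measurable; apply: (@sigma_of_finite_time _ _ _ _ (k + j).+1
  (fun x => (forall i, (i <= k)%N -> x i = p i) /\
            (forall i, (k < i <= k + j)%N -> x i \notin F))).
move=> x y xy [xp xF]; split=> i ik.
  by rewrite -xy ?xp // ltnS (leq_trans ik) // leq_addr.
by rewrite -xy ?xF // ltnS; case/andP: ik.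
Qed.

(** Markov property linking the actual walk to the recursion [avoid]: given the past up to time [k],
    avoidance depends only on [p k]. In the induction the next position is absorbed into the
    prescribed past. *)
Lemma srw_cyl_avoid (F : {set V}) j p k :
  P (cyl_avoid F p k j) = ((avoid R e F j (p k))%:E * P (cyl p k))%E.
Proof.
have [_ _ step] := srwX.
elim: j p k => [|j IHj] p k.
  rewrite mul1e; congr (P _); apply/seteqP; split=> w /=; first by case.
  by move=> h; split=> // i; rewrite addn0 ltnNge => /andP[/negP].
pose p' y i := if (i <= k)%N then p i else y.
pose D y := if y \in F then set0 else cyl_avoid F (p' y) k.+1 j.
have mD y : measurable (D y) by rewrite /D; case: ifP.
have p'k y i : (i <= k)%N -> p' y i = p i by rewrite /p' => ->.
have p'S y : p' y k.+1 = y by rewrite /p' ltnn.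
have -> : cyl_avoid F p k j.+1 = \bigcup_y D y.
  apply/seteqP; split=> w.
    case=> Xp XF; exists (X k.+1 w) => //.
    rewrite /D ifN ?XF ?ltnSn ?addnS ?ltnS ?leq_addr //; split=> i.
      rewrite leq_eqVlt => /orP[/eqP->|]; first by rewrite p'S.
      by rewrite ltnS => ik; rewrite p'k ?Xp.
    by move=> /andP[ki ij]; apply: XF; rewrite addnS -addSn ij andbT ltnW.
  case=> y _; rewrite /D; case: ifPn => // yF [Xp XF]; split=> i.
    by move=> ik; rewrite Xp ?p'k // ltnW.
  move=> /andP[]; rewrite leq_eqVlt => /orP[/eqP<- _|ki ij].
    by rewrite Xp // p'S.
  by apply: XF; rewrite ki addSn -addnS.
rewrite measure_bigcup_finType //; last first.
  move=> y z w; rewrite /D; do 2 case: ifP => // _.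
  by case=> h1 _ [h2 _]; rewrite -(p'S y) -(p'S z) -h1 // h2.
have finC : P (cyl p k) \is a fin_num.
  apply: fin_num_measure; apply: srw_measurable.
  apply: (@sigma_of_finite_time _ _ _ _ k.+1
    (fun x => forall i, (i <= k)%N -> x i = p i)).
  by move=> x y xy h i ik; rewrite -xy ?h.
rewrite /= -sumEFin ge0_sume_distrl; last first.
  by move=> y _; rewrite lee_fin mulr_ge0 ?srw_step_ge0 ?avoid_ge0.
rewrite [RHS]big_mkcond; apply: eq_bigr => y _; rewrite /D.
case: ifPn => yF; first by rewrite measure0.
rewrite IHj p'S step p'S p'k // muleA -EFinM mulrC; congr (_ * P _)%E.
apply/seteqP; split=> w h i ik; first by rewrite h ?p'k.
by rewrite p'k ?h.
Qed.

Lemma srw_start : {ae P, forall w, X 0%N w = v}.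
Proof.
have [mX PX _] := srwX; exists (~` [set w | X 0%N w = v]); split => //.
  exact: measurableC.
by rewrite probability_setC // PX subee.
Qed.

(** A cylinder ending with a non-edge has probability 0, and there are finitely many cylinders of a
    given length. *)
Lemma srw_step_ae k : {ae P, forall w, e (X k w) (X k.+1 w)}.
Proof.
have [mX _ step] := srwX.
suff: {ae P, forall w, forall q : k.+2.-tuple V,
    cyl (nth v q) k.+1 w -> e (nth v q k) (nth v q k.+1)}.
  apply: filterS => w h; pose q := [tuple of mkseq (X^~ w) k.+2].
  have qE i : (i <= k.+1)%N -> nth v q i = X i w by move=> ik; apply: nth_mkseq.
  by have := h q; rewrite !qE //; apply=> i ik; rewrite qE.
apply: filter_forall => q; have [eq|neq] := boolP (e (nth v q k) (nth v q k.+1)).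
  by apply: aeW.
exists (cyl (nth v q) k.+1); split => //.
- apply: srw_measurable; apply: (@sigma_of_finite_time _ _ _ _ k.+2
    (fun x => forall i, (i <= k.+1)%N -> x i = nth v q i)).
  by move=> x y xy h i ik; rewrite -xy ?h.
- by rewrite step /srw_step (negPf neq) mul0e.
- by move=> w /=; rewrite not_implyE => -[].
Qed.

Lemma srw_measurable_before (F : {set V}) l :
  measurable [set w | forall i, (i < l)%N -> X i w \notin F].
Proof.
apply: srw_measurable; apply: (@sigma_of_finite_time _ _ _ X l
  (fun x => forall i, (i < l)%N -> x i \notin F)).
by move=> x y xy h i il; rewrite -xy ?h.
Qed.

Section Tail.
Variables (F : {set V}) (D N : nat).
Hypotheses (D0 : (0 < D)%N) (N0 : (0 < N)%N).
Hypothesis deg_D : forall x, x \notin F -> (#|[pred z | e x z]| <= D)%N.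
Hypothesis path_F : forall x, x \notin F ->
  exists p, [/\ path e x p, last x p \in F & (size p <= N)%N].

Lemma avoid_decay j x : x \notin F ->
  avoid R e F j x <= decay_rate R D N ^- N * decay_rate R D N ^+ j.
Proof.
have [t0 t1 tN] := decay_rate_bounds R D0 N0.
move=> xF; apply: avoid_geometric => //; first exact: ltW.
move=> y yF; have [p [ep lp sp]] := path_F yF; apply: le_trans tN.
(* Here [delta] is the inverse of [D]: off [F] every edge is taken with at least that
   probability. *)
rewrite -exprVn; apply: avoid_path ep yF lp sp.
- by rewrite invr_ge0.
- by rewrite invf_le1 ?ler1n // ltr0n.
- move=> a b aF ab; rewrite /srw_step ab lef_pV2 ?posrE ?ltr0n //.
    by rewrite ler_nat deg_D.
  by apply/card_gt0P; exists b.
Qed.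

(** Being off [F] at times 0 to [l - 1] involves only [l - 1] steps; the lost step gives the extra
    inverse factor in the exponent [N.+1]. *)
Lemma srw_hitting_tail l : v \notin F ->
  (P [set w | forall i, (i < l)%N -> X i w \notin F] <=
   (decay_rate R D N ^- N.+1 * decay_rate R D N ^+ l)%:E)%E.
Proof.
move=> vF; have [mX PX _] := srwX.
have [t0 t1 tN] := decay_rate_bounds R D0 N0; set t := decay_rate R D N in t0 t1 tN *.
have mAl : measurable [set w | forall i, (i < l)%N -> X i w \notin F].
  exact: srw_measurable_before.
case: l mAl => [mAl|l mAl].
  apply: le_trans (probability_le1 _ mAl) _.
  by rewrite lee_fin expr0 mulr1 invf_ge1 ?exprn_gt0 // exprn_ile1 // ltW.
(* The walk starts at [v] only almost surely, so the comparison is made up to the null event of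
   another start. *)
apply: (@le_trans _ _ (P (cyl_avoid F (fun=> v) 0 l))).
  have nv : P (~` [set w | X 0%N w = v]) = 0%E by rewrite probability_setC // PX subee.
  apply: (@le_trans _ _ (P (cyl_avoid F (fun=> v) 0 l `|` ~` [set w | X 0%N w = v]))).
    apply: le_measure; rewrite ?inE //.
      by apply: measurableU => //; exact: measurableC.
    move=> w h; have [Xv|] := pselect (X 0%N w = v); last by right.
    left; split=> i; first by rewrite leqn0 => /eqP->.
    by rewrite add0n => /andP[_ il]; apply: h.
  apply: le_trans (measureU2 P _ _) _; [exact: cyl_avoid_measurable|exact: measurableC|].
  by rewrite [X in (_ + X)%E]nv adde0.
rewrite srw_cyl_avoid (_ : cyl _ 0 = [set w | X 0%N w = v]); last first.
  apply/seteqP; split=> w /=; first exact.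
  by move=> Xv i; rewrite leqn0 => /eqP->.
rewrite PX mule1 lee_fin; apply: le_trans (avoid_decay l vF) _; rewrite -/t.
by rewrite !exprS invfM mulrACA mulVf ?gt_eqF // mul1r.
Qed.

(** Never hitting [F] lies in all the tail events, whose bounds tend to 0. *)
Lemma srw_hits_ae : {ae P, forall w, exists k, X k w \in F}.
Proof.
have [t0 t1 _] := decay_rate_bounds R D0 N0.
have [mX PX _] := srwX; have [vF|vF] := boolP (v \in F).
  by apply: filterS srw_start => w Xv; exists 0%N; rewrite Xv.
pose A := \bigcap_l [set w | forall i, (i < l)%N -> X i w \notin F].
have mA : measurable A.
  by apply: bigcapT_measurable => l; apply: srw_measurable_before.
exists A; split => //; last first.
  by move=> w nh l _ i _ /=; apply/negP => Xi; apply: nh; exists i.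
have PA l : (P A <= (decay_rate R D N ^- N.+1 * decay_rate R D N ^+ l)%:E)%E.
  apply: le_trans (srw_hitting_tail l vF); apply: le_measure; rewrite ?inE //.
    exact: srw_measurable_before.
  by move=> w /(_ l I).
have Pfin : P A \is a fin_num by apply: fin_num_measure.
apply/eqP; rewrite eq_le measure_ge0 andbT -(fineK Pfin) lee_fin.
have cvg0 : (fun l => decay_rate R D N ^- N.+1 * decay_rate R D N ^+ l) @ \oo --> (0 : R).
  rewrite -(mulr0 (decay_rate R D N ^- N.+1)); apply: cvgMr.
  by apply: cvg_expr; rewrite ger0_norm //; exact: ltW.
rewrite -(cvg_lim _ cvg0) //; apply: limr_ge; first by apply/cvg_ex; exists 0.
by near=> l; rewrite -lee_fin fineK.
Unshelve. all: by end_near. Qed.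

End Tail.

End Walk.

(** * Independence of the current tree and the next walk *)

Lemma wilson_treeS (V : finType) (r : V) o X k :
  wilson_tree r o X k.+1 = obind (wilson_step o X) (wilson_tree r o X k).
Proof. by []. Qed.

Section Factorization.
Context (R : realType) (d : measure_display) (Omega : measurableType d).
Variables (P : probability Omega R) (V : finType) (e : rel V) (r : V).
Variables (o : seq V) (W : V -> nat -> Omega -> V).
Hypothesis ord_o : is_ordering r o.
Hypothesis walksW : wilson_walks P e o W.
Local Open Scope classical_set_scope.

Implicit Types (T : {set V} * {set {set V}}) (J : {set V}).

Let treeE k T := [set w | wilson_tree r o (walks_at W w) k = Some (T : subgraph V)].
Let stepE T' T :=
  [set w | wilson_step o (walks_at W w) T' = Some (T : subgraph V)].

Let stepE_sigma T' T v : next_start o T' = Some v -> sigma_of (W v) (stepE T' T).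
Proof.
move=> E; rewrite (_ : stepE _ _ = [set w | exists2 b,
    increment_from (walks_at W w) v T' = Some b & add_path T' b = T]).
  exact: sigma_of_increment_from.
apply/seteqP; split=> w; rewrite /stepE /= /wilson_step E.
  by case: increment_from => //= b [<-]; exists b.
by case=> b -> /= ->.
Qed.

Let stepE_none T' T : next_start o T' = None -> stepE T' T = [set _ | T' = T].
Proof.
move=> E; apply/seteqP; split=> w; rewrite /stepE /= /wilson_step E; first by case.
by move=> ->.
Qed.

Let walk_sigma_measurable v A : v \in o -> sigma_of (W v) A -> measurable A.
Proof. by case: walksW => srwW _ /srwW h; apply: srw_measurable h _. Qed.

Let stepE_measurable T' T : measurable (stepE T' T).
Proof.
case E: (next_start o T') => [v|]; last first.
  rewrite stepE_none //; have [->|TT] := eqVneq T' T.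
    by rewrite (_ : [set _ | _] = setT) //; apply/seteqP; split.
  rewrite (_ : [set _ | _] = set0) //; apply/seteqP; split=> // w /= h.
  by rewrite h eqxx in TT.
have [vo _] := next_start_some E.
exact: walk_sigma_measurable (stepE_sigma _ E).
Qed.

Let treeE_succ k T : treeE k.+1 T = \bigcup_T' (treeE k T' `&` stepE T' T).
Proof.
apply/seteqP; split=> w; rewrite /treeE /stepE /mkset wilson_treeS.
  by case E: (wilson_tree _ _ (walks_at W w) k) => [T0|] //= h; exists T0.
by case=> T' _ [/= -> h].
Qed.

Lemma wilson_tree_measurable k T : measurable (treeE k T).
Proof.
elim: k T => [|k IHk] T; last first.
  rewrite treeE_succ; apply: fin_bigcup_measurable; first exact: finite_finset.
  by move=> T' _; apply: measurableI.
have [E|E] := pselect (Some (([set r]%SET, finset.set0) : subgraph V) = Some (T : subgraph V)).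
  by rewrite (_ : treeE _ _ = setT) //; apply/seteqP; split.
by rewrite (_ : treeE _ _ = set0) //; apply/seteqP; split.
Qed.

(* The null case [v \in J] below: an increment started at [v] contains [v]
   almost surely, so it cannot lead to a tree avoiding [v]. *)
Lemma wilson_tree_factor k T J (A : V -> set Omega) :
  {subset J <= o} -> [disjoint J & vertices T]%B ->
  (forall v, v \in J -> sigma_of (W v) (A v)) ->
  P (treeE k T `&` [set w | forall v, v \in J -> A v w]) =
  (P (treeE k T) * \prod_(v in J) P (A v))%E.
Proof.
have [srwW indW] := walksW.
(* The induction is uniform in [J] and [A], because undoing one step of the algorithm adds its
   starting vertex to [J]. *)
elim: k T J A => [|k IHk] T J A Jo dJT sA.
  have [E|E] := pselect (Some (([set r]%SET, finset.set0) : subgraph V) = Some (T : subgraph V)).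
    rewrite (_ : treeE _ _ = setT); last by apply/seteqP; split.
    by rewrite setTI probability_setT mul1e indW.
  by rewrite (_ : treeE _ _ = set0) ?set0I ?measure0 ?mul0e //; apply/seteqP; split.
set AJ := [set w | _].
have mAJ : measurable AJ.
  rewrite (_ : AJ = \bigcap_(v in [set` J]) A v) //.
  apply: fin_bigcap_measurable; first exact: finite_finset.
  move=> v vJ; exact: walk_sigma_measurable (Jo _ vJ) (sA _ vJ).
have mTS T' : measurable (treeE k T' `&` stepE T' T).
  by apply: measurableI => //; exact: wilson_tree_measurable.
have disj T' T'' w : treeE k T' w -> treeE k T'' w -> T' = T''.
  by rewrite /treeE /= => -> [].
rewrite treeE_succ setI_bigcupl measure_bigcup_finType; last 2 first.
- by move=> T'; apply: measurableI.
- by move=> T' T'' w [[+ _] _] [[+ _] _]; apply: disj.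
rewrite measure_bigcup_finType //; last first.
  by move=> T' T'' w [+ _] [+ _]; apply: disj.
rewrite ge0_sume_distrl //; apply: eq_bigr => T' _.
change (P (treeE k T' `&` stepE T' T `&` AJ) =
  (P (treeE k T' `&` stepE T' T) * \prod_(v in J) P (A v))%E).
case E: (next_start o T') => [v|]; last first.
  rewrite stepE_none //; have [->|TT] := eqVneq T' T.
    rewrite (_ : [set _ | _] = setT); last by apply/seteqP; split.
    by rewrite setIT; exact: IHk.
  rewrite (_ : [set _ | _] = set0); last first.
    by apply/seteqP; split=> // w /= h; rewrite h eqxx in TT.
  by rewrite setI0 set0I measure0 mul0e.
have [vo vT'] := next_start_some E.
have sS := stepE_sigma T E.
have stepEP w : stepE T' T w -> exists b t,
    [/\ b = loop_erasure (mkseq (W v ^~ w) t.+1) & add_path T' b = T].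
  rewrite /stepE /= /wilson_step E.
  case Eb: increment_from => [b|] //= [<-].
  by have /increment_fromP[t [_ _ ->]] := Eb; exists (loop_erasure (mkseq (W v ^~ w) t.+1)), t.
(* Trees only grow, so a step from [T'] to [T] is impossible unless the vertices of [T'] are among
   those of [T]. *)
have [sub|nsub] := boolP (vertices T' \subset vertices T); last first.
  rewrite (_ : stepE T' T = set0); first by rewrite setI0 set0I measure0 mul0e.
  apply/seteqP; split=> // w /stepEP[b [t [_ ET]]]; move/negP: nsub; apply.
  by rewrite -ET; apply: finset.subsetUl.
have [vJ|vJ] := boolP (v \in J).
  have vT : v \notin vertices T by rewrite (disjointFr dJT vJ).
  have null : P (stepE T' T) = 0%E.
    have [mX PX _] := srwW v vo.
    apply/eqP; rewrite eq_le measure_ge0 andbT.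
    have <- : P (~` [set w | W v 0%N w = v]) = 0%E.
      by rewrite probability_setC // PX subee.
    apply: le_measure; rewrite ?inE //; first exact: measurableC.
    move=> w /stepEP[b [t [Eb ET]]] /= Wv; move/negP: vT; apply; rewrite -ET.
    rewrite finset.in_setU; apply/orP; right; rewrite inE Eb /mkseq /=.
    have [q ->] := loop_erasure_head (W v 0%N w) [seq W v i w | i <- iota 1 t].
    by rewrite Wv mem_head.
  have null' B : measurable B -> P (B `&` stepE T' T) = 0%E.
    move=> mB; apply/eqP; rewrite eq_le measure_ge0 andbT -null.
    apply: le_measure; rewrite ?inE //.
    exact: measurableI.
  rewrite setIAC !null' ?mul0e //; first exact: wilson_tree_measurable.
  by apply: measurableI => //; exact: wilson_tree_measurable.
have dJT' : [disjoint J & vertices T']%B by apply: disjointWr dJT.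
(* The last step is an event about the walk from [v], which is outside [T']; it joins the family [A]
   and the induction hypothesis applies to [T'] and [v |: J]. *)
pose A' u := if u == v then stepE T' T else A u.
have A'J u : u \in J -> A' u = A u.
  by rewrite /A'; case: eqP => // -> vJ'; rewrite vJ' in vJ.
have A'v : A' v = stepE T' T by rewrite /A' eqxx.
have IH1 := IHk T' (v |: J)%SET A'.
rewrite big_setU1 //= A'v in IH1.
rewrite (eq_bigr (fun u => P (A u))) in IH1; last by move=> u uJ; rewrite A'J.
have {IH1} : P (treeE k T' `&` (stepE T' T `&` AJ)) =
    (P (treeE k T') * (P (stepE T' T) * \prod_(u in J) P (A u)))%E.
  rewrite -IH1.
  - congr (P (_ `&` _)); apply/seteqP; split=> w.
      move=> [Sw Aw] u; rewrite !inE => /orP[/eqP->|uJ]; first by rewrite A'v.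
      by rewrite A'J //; apply: Aw.
    move=> h; split; first by rewrite -A'v; apply: h; rewrite !inE eqxx.
    by move=> u uJ; rewrite -A'J //; apply: h; rewrite !inE uJ orbT.
  - by move=> u; rewrite !inE => /orP[/eqP->|/Jo].
  - by rewrite finset.disjoints_subset finset.subUset finset.sub1set inE vT' -finset.disjoints_subset.
  - by move=> u; rewrite !inE => /orP[/eqP->|uJ]; rewrite ?A'v // A'J //; apply: sA.
rewrite setIA => ->; rewrite muleA; congr (_ * _)%E.
(* The induction hypothesis for [v] alone turns the product for [T'] and the step back into the
   probability of their intersection. *)
have := IHk T' [set v]%SET (fun=> stepE T' T); rewrite big_set1 => <- //.
- congr (P (_ `&` _)); apply/seteqP; split=> w.
    by move=> h; apply: (h v); rewrite inE.
  by move=> Sw u _.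
- by move=> u; rewrite inE => /eqP->.
- by rewrite disjoints1.
- by move=> u; rewrite inE => /eqP->.
Qed.

Lemma wilson_tree_root (X : V -> nat -> V) k T :
  wilson_tree r o X k = Some (T : subgraph V) -> r \in vertices T.
Proof.
elim: k T => [|k IHk] T; first by move=> [<-]; rewrite inE.
rewrite wilson_treeS.
case E: wilson_tree => [T'|] //=; have rT' := IHk _ E.
rewrite /wilson_step; case: next_start => [v|]; last by case=> <-.
by case: increment_from => //= b [<-]; rewrite !inE rT'.
Qed.

Lemma root_in_charged_tree k T : (0 < P (treeE k T))%E -> r \in vertices T.
Proof.
move=> PT; have [w Tw] : exists w, treeE k T w; last exact: wilson_tree_root Tw.
apply/not_existsP => h; rewrite (_ : treeE k T = set0) ?measure0 ?ltxx // in PT.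
by apply/seteqP; split=> // w /h.
Qed.

(** Fixing [F] fixes the next start [v], so a long increment becomes an event about the walk from
    [v]. Factorization cancels the probability of [F], leaving the hitting tail of a single walk. *)
Lemma wilson_increment_tail (F : subgraph V) k l D N :
  (0 < D)%N -> (0 < N)%N ->
  (forall x, x \notin vertices F -> (#|[pred z | e x z]| <= D)%N) ->
  (forall x, x \notin vertices F ->
    exists p, [/\ path e x p, last x p \in vertices F & (size p <= N)%N]) ->
  vertices F != [set: V]%SET ->
  let treeF := [set w | wilson_tree r o (walks_at W w) k = Some F] in
  let long := [set w | exists2 beta,
      wilson_increment r o (walks_at W w) k = Some beta &
      (l <= path_length beta)%N] in
  (0 < P treeF)%E ->
  cond_prob P long treeF <= decay_rate R D N ^- N.+1 * decay_rate R D N ^+ l.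
Proof.
move=> D0 N0 degD pathF FT treeF long PF.
have rF : r \in vertices F by apply: root_in_charged_tree PF.
case E: (next_start o F) => [v|]; last first.
  by rewrite (next_start_none ord_o rF E) eqxx in FT.
have [vo vF] := next_start_some E.
pose B := [set w | exists2 b, increment_from (walks_at W w) v F = Some b &
  (l <= path_length b)%N].
have sB : sigma_of (W v) B by apply: sigma_of_increment_from.
have EB : long `&` treeF = treeF `&` [set w | forall u, u \in [set v]%SET -> B w].
  rewrite /long /treeF /wilson_increment; apply/seteqP; split=> u /=.
    by move=> [+ uF]; rewrite uF /= E /= => h; split=> // ? _.
  move=> [uF h]; split=> //; rewrite uF /= E /=.
  by apply: (h v); rewrite inE.
have mB : measurable B by apply: walk_sigma_measurable sB.
have finF : P treeF \is a fin_num.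
  by apply: fin_num_measure; apply: wilson_tree_measurable.
have finB : P B \is a fin_num by apply: fin_num_measure.
rewrite /cond_prob EB (wilson_tree_factor k (T := F) (J := [set v]%SET)) //; last 3 first.
- by move=> u; rewrite inE => /eqP->.
- by rewrite disjoints1.
- by move=> u; rewrite inE => /eqP->.
rewrite big_set1 fineM // mulrAC mulfV ?mul1r; last first.
  by rewrite gt_eqF // fine_gt0 // PF ltey_eq finF.
rewrite -lee_fin fineK //.
have [srwW _] := walksW.
apply: le_trans (srw_hitting_tail (srwW v vo) D0 N0 degD pathF l vF).
apply: le_measure; rewrite ?inE //.
  exact: srw_measurable_before (srwW v vo) _ _.
(* A walk stopped at time [t] has [t.+1] positions, so its erasure has at most [t] edges; hence
   [l <= t], and [F] is avoided at all times below [l]. *)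
move=> u [b /increment_fromP[t [_ Xlt ->]] lb] i il; apply: Xlt.
apply: leq_trans il (leq_trans lb _); rewrite /path_length.
have := size_loop_erasure (mkseq (walks_at W u v) t.+1).
by rewrite size_mkseq; case: size.
Qed.

End Factorization.

(** * The cylinder *)

Section CylinderGraph.
Variables n m : nat.
Local Notation Vertex := ('I_n * 'I_m)%type.
Implicit Types x y : Vertex.

Lemma cyl_adj_sym : symmetric (@cyl_adj n m).
Proof.
move=> x y; rewrite /cyl_adj (eq_sym y.2 x.2) (eq_sym y.1 x.1).
by congr (_ && _ || _ && _); exact: orbC.
Qed.

Lemma val_iter_ordS (i : 'I_n) k : iter k (@ordS n) i = ((i + k) %% n)%N :> nat.
Proof.
elim: k => [|k IHk] /=; first by rewrite addn0 modn_small.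
by rewrite IHk -addn1 modnDml addn1 addnS.
Qed.

Lemma ring_path x y : x.2 = y.2 ->
  exists p, [/\ path (@cyl_adj n m) x p, last x p = y & (size p <= n)%N].
Proof.
case: x y => [i j] [i' j'] /= <-.
(* [k] is the residue of [i' - i] modulo [n]: the number of successor steps from [i] to [i']. *)
pose f (u : Vertex) : Vertex := (ordS u.1, u.2); pose k := ((i' + (n - i)) %% n)%N.
have itf h : iter h f (i, j) = (iter h (@ordS n) i, j).
  by elim: h => //= h ->.
exists (traject f (f (i, j)) k); split.
- apply: sub_path (fpath_traject f (i, j) k) => u z /eqP <-.
  by rewrite /cyl_adj !eqxx.
- rewrite last_traject itf; congr pair; apply: val_inj; rewrite /= val_iter_ordS.
  rewrite /k modnDmr addnCA subnKC ?modnDr ?modn_small //; exact: ltnW.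
- rewrite size_traject /k ltnW // ltn_mod; exact: leq_ltn_trans (ltn_ord i).
Qed.

Lemma cyl_connect x y : connect (@cyl_adj n m) x y.
Proof.
have m0 : (0 < m)%N := leq_ltn_trans (leq0n _) (ltn_ord x.2).
have csym := sym_connect_sym cyl_adj_sym.
have up i k (km : (k < m)%N) :
    connect (@cyl_adj n m) (i, Ordinal m0) (i, Ordinal km).
  elim: k km => [|k IHk] km.
    by rewrite (_ : Ordinal km = Ordinal m0) //; apply: val_inj.
  apply: connect_trans (IHk (ltnW km)) (connect1 _).
  by rewrite /cyl_adj /= !eqxx orbT.
have rot : connect (@cyl_adj n m) x (y.1, x.2).
  have [p [pp lp _]] := @ring_path x (y.1, x.2) erefl.
  by apply/connectP; exists p.
apply: connect_trans rot _.
case: x y => [i [j jm]] [i' [j' jm']] /=.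
by apply: connect_trans (up i' j' jm'); rewrite csym.
Qed.

(** The length bound depends on [m]; it serves almost sure hitting of the root in part (1), where no
    uniformity is required. *)
Lemma cyl_path x y : exists p,
  [/\ path (@cyl_adj n m) x p, last x p = y & (size p <= #|{: Vertex}|)%N].
Proof.
have /connectP[p pp ->] := cyl_connect x y.
case/shortenP: pp => q pq /card_uniqP Uq _; exists q; split => //.
by apply: ltnW; rewrite -[X in (X <= _)%N]/(size (x :: q)) -Uq max_card.
Qed.

(** On a boundary ring [insubd] falls back to the ring of [x], so the list may contain [x] itself;
    it serves as an upper bound for the neighbourhood. *)
Let neighbours x : seq Vertex :=
  [:: (ordS x.1, x.2); (ord_pred x.1, x.2);
      (x.1, insubd x.2 x.2.+1); (x.1, insubd x.2 x.2.-1)].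

Let mem_neighbours x y : cyl_adj x y -> y \in neighbours x.
Proof.
case: x y => [i j] [i' j']; rewrite /cyl_adj /= !inE !xpair_eqE.
case/orP=> /andP[/eqP-> /orP[]/eqP E].
- by rewrite E !eqxx.
- by rewrite E ordSK !eqxx orbT.
- rewrite (_ : j' = insubd j j.+1) ?eqxx ?orbT //.
  by apply: val_inj; rewrite val_insubd -E ltn_ord.
- rewrite [X in [|| _, _, _ | X]](_ : _ = true) ?orbT // eqxx /=.
  by apply/eqP/val_inj; rewrite val_insubd E /= ltn_ord.
Qed.

Lemma cyl_degree x : (#|[pred z | cyl_adj x z]| <= 5)%N.
Proof.
apply: leq_trans (_ : #|neighbours x| <= 5)%N; last first.
  by apply: leq_trans (card_size _) _.
by apply: subset_leq_card; apply/fintype.subsetP => y /mem_neighbours.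
Qed.

(** At most four cylinder neighbours, plus the sink. The sink itself has degree growing with [n],
    but it belongs to every tree rooted there. *)
Lemma wired_degree x : (#|[pred z | wired_adj (Some x) z]| <= 5)%N.
Proof.
apply: leq_trans (_ : #|None :: map Some (neighbours x)| <= 5)%N; last first.
  by apply: leq_trans (card_size _) _.
apply: subset_leq_card; apply/fintype.subsetP => -[y|//].
move=> /mem_neighbours yx; rewrite in_cons; apply/orP; right.
exact: (map_f Some yx).
Qed.

(** A discrete intermediate value theorem: the ring index changes by at most one along an edge. Both
    orders of the endpoints are covered, as the root may lie on either boundary ring. *)
Lemma path_meets_rings x p (k : 'I_m) : path (@cyl_adj n m) x p ->
  (x.2 <= k <= (last x p).2)%N || ((last x p).2 <= k <= x.2)%N ->
  exists2 u, u \in x :: p & u.2 = k.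
Proof.
elim: p x => [|y p IHp] x /=.
  move=> _ h; exists x; first by rewrite mem_head.
  by apply: val_inj => /=; lia.
move=> /andP[xy pp] h; have [xk|xk] := eqVneq (x.2 : nat) k.
  by exists x; [rewrite mem_head | apply: val_inj].
have [|u up uk] := IHp y pp; last by exists u; rewrite // in_cons up orbT.
have: (y.2 <= x.2.+1)%N && (x.2 <= y.2.+1)%N.
  move: xy; rewrite /cyl_adj => /orP[/andP[/eqP-> _]|/andP[_ /orP[]/eqP->]]; lia.
by move: h xk; lia.
Qed.

End CylinderGraph.

(** * The trunk property and the uniform tail bound *)

Theorem lemma2 (R : realType) (n : nat) (hn : (3 <= n)%N) :
  (forall (m : nat) (d : measure_display) (Omega : measurableType d)
          (P : probability Omega R) (r v : 'I_n * 'I_m)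
          (o : seq ('I_n * 'I_m))
          (W : 'I_n * 'I_m -> nat -> Omega -> 'I_n * 'I_m),
     (2 <= m)%N ->
     ((r.2 = 0 :> nat)%N /\ (v.2 = m.-1 :> nat)%N) \/
     ((r.2 = m.-1 :> nat)%N /\ (v.2 = 0 :> nat)%N) ->
     is_ordering r (v :: o) ->
     wilson_walks P (@cyl_adj n m) (v :: o) W ->
     {ae P, forall w, exists L T,
        [/\ wilson_increment r (v :: o) (walks_at W w) 0 = Some L,
            wilson_output r (v :: o) (walks_at W w) T &
            is_trunk (@cyl_adj n m) (@ring_of n m) T L]})
  /\
  (exists C theta : R,
     [/\ 0 < theta, theta < 1 &
       forall m : nat, (2 <= m)%N ->
         (forall r : 'I_n * 'I_m,
            increment_tail_bound (@cyl_adj n m) (@ring_of n m) r C theta) /\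
         increment_tail_bound (@wired_adj n m) (@wired_ring_of n m) None
           C theta]).
Proof.
have n0 : (0 < n)%N by apply: leq_trans hn.
split=> [m d Omega P r v o W m2 rv ord_o [srwW _]|].
  have vr : v \in v :: o by rewrite mem_head.
  (* Stated as an implication for every vertex, so that finitely many almost sure events combine
     into one. *)
  have good u : {ae P, forall w, u \in v :: o -> [/\ W u 0%N w = u,
      forall k, cyl_adj (W u k w) (W u k.+1 w) & exists k, W u k w = r]}.
    have [uo|_] := boolP (u \in v :: o); last by apply: aeW.
    have srwu := srwW u uo.
    have hit : {ae P, forall w, exists k, W u k w \in [set r]%SET}.
      apply: (@srw_hits_ae _ _ _ _ _ _ _ _ srwu [set r]%SET 5 #|{: 'I_n * 'I_m}|) => //.
      - by apply/card_gt0P; exists r.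
      - by move=> x _; apply: cyl_degree.
      - move=> x _; have [p [pp lp sp]] := cyl_path x r.
        by exists p; split => //; rewrite inE lp.
    have steps := ae_foralln (srw_step_ae srwu).
    have start := srw_start srwu.
    apply: filterS3 start steps hit => w h1 h2 [k h3] _; split=> //.
    by exists k; move: h3; rewrite inE => /eqP.
  apply: filterS (filter_forall _ good) => w gw.
  have [|||L [T [p [HL HT sT [EL pp UL lp] [sv se]]]]] :=
    @wilson_spanning _ (@cyl_adj n m) r (v :: o) (walks_at W w) ord_o _ _ _ v o erefl.
  - by move=> u /gw[].
  - by move=> u k /gw[_ + _]; apply.
  - by move=> u /gw[].
  exists L, T; split => //; split => //.
    by rewrite /is_simple_path UL EL /= pp.
  move=> k; have [|u uL uk] := @path_meets_rings n m v p k pp.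
    by rewrite lp; have := ltn_ord k; case: rv => -[-> ->]; lia.
  by exists u; rewrite ?EL // inE uk.
have [t0 t1 _] := @decay_rate_bounds R 5 n isT n0.
(* Degrees off [F] are at most 5 and [F] is reached within [n] steps, so [D] is 5 and [N] is [n],
   both free of [m]. *)
exists (decay_rate R 5 n ^- n.+1), (decay_rate R 5 n); split=> // m m2; split.
  move=> r d Omega P o W k F l ord_o walksW ringsF FT treeF long PF.
  apply: (wilson_increment_tail ord_o walksW) => //.
    by move=> x _; apply: cyl_degree.
  (* [F] meets the ring of [x], and the walk can reach that point by turning along the ring. *)
  move=> x _; have /set0Pn[y] := ringsF x.2.
  rewrite !inE => /andP[yF /eqP xy].
  by have [p [pp lp sp]] := ring_path (esym xy); exists p; rewrite lp.
move=> d Omega P o W k F l ord_o walksW ringsF FT treeF long PF.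
(* The sink is the root and so lies in [F]; the degree and path conditions then concern cylinder
   vertices only. *)
have rF : None \in vertices F by apply: (@root_in_charged_tree _ _ _ P _ None o W k F PF).
apply: (wilson_increment_tail ord_o walksW) => //.
  by move=> [x|/negP//] _; apply: wired_degree.
move=> [x|/negP//] _; have /set0Pn[z] := ringsF x.2.
rewrite finset.in_setI => /andP[zF /imsetP[y]]; rewrite inE => /eqP xy Ez.
have [p [pp lp sp]] := ring_path (esym xy); exists (map Some p).
by rewrite path_map last_map lp size_map -Ez.
Qed.
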